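(* Let $\mathbb{F}\in\{\mathbb{R},\mathbb{C}\}$, $q\ge2$, and let $\mathscr{O}=\{O_i\}_{i=1}^n$ be self-adjoint $q\times q$ matrices over $\mathbb{F}$, with quantum design tensor $\mathfrak{D}:\mathbb{F}^{q\times q}_{sa}\to\mathbb{R}^{n\times q}$. The adjoint of $\mathfrak{D}$ (with respect to the Frobenius inner products) is $$\mathfrak{D}^*:\mathbb{R}^{n\times q}\to\mathbb{F}^{q\times q}_{sa},\qquad A=(a_{i\ell})\mapsto\sum_{i=1}^n\sum_{k=1}^{q_i}\bar a_{ik}\Pi_{ik},\qquad \bar a_{ik}=\frac1{m_{ik}}\sum_{\ell:\,k_i(\ell)=k}a_{i\ell}.$$ Additionally, the following are equivalent: 1. $\mathscr{O}$ is a complete design. 2. The real linear span of $\{\Pi_{ik}:1\le i\le n,\ 1\le k\le q_i\}$ is $\mathbb{F}^{q\times q}_{sa}$. 3. $\mathfrak{D}:\mathbb{F}^{q\times q}_{sa}\to\mathbb{R}^{n\times q}$ is injective.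
   Context: $\mathbb{F}^{q\times q}_{sa}$ is the real vector space of self-adjoint (symmetric if $\mathbb{F}=\mathbb{R}$, Hermitian if $\mathbb{F}=\mathbb{C}$) $q\times q$ matrices with Frobenius inner product $\langle A,B\rangle_2=\mathrm{Tr}[AB]$. Each $O_i$ has spectral decomposition $O_i=\sum_{k=1}^{q_i}\lambda_{ik}\Pi_{ik}$ with distinct eigenvalues, orthogonal eigenprojections $\Pi_{ik}$, and multiplicities $m_{ik}=\mathrm{Tr}[\Pi_{ik}]$; it is assumed that $q_i\ge2$. For $S\in\mathbb{F}^{q\times q}_{sa}$, $d_{ik}[S]=\mathrm{Tr}[S\Pi_{ik}]$. The index map $k_i:\{1,\dots,q\}\to\{1,\dots,q_i\}$ is given by $k_i(\ell)=k$ iff $\sum_{k'<k}m_{ik'}<\ell\le\sum_{k'\le k}m_{ik'}$. The quantum design tensor is $(\mathfrak{D}[S])_{i\ell}=d_{i\,k_i(\ell)}[S]/m_{i\,k_i(\ell)}$, $1\le i\le n$, $1\le\ell\le q$. $\mathscr{O}$ is a complete design if for every traceless $\Delta\in\mathbb{F}^{q\times q}_{sa}$: $d_{ik}[\Delta]=0$ for all $i,k$ if and only if $\Delta=0$. *)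

(* Defs.v *)
From HB Require Import structures.
From mathcomp Require Import all_boot all_order all_algebra.
From mathcomp Require Import boolp classical_sets reals.
From mathcomp Require Import complex.

Set Implicit Arguments.
Unset Strict Implicit.
Unset Printing Implicit Defensive.

Import Order.TTheory GRing.Theory Num.Theory.
Local Open Scope ring_scope.

Inductive scalar_kind := RealScalars | ComplexScalars.

Definition scalars (R : realType) (K : scalar_kind) : numFieldType :=
  match K with
  | RealScalars => R
  | ComplexScalars => R[i]%C
  end.

Definition conjF (R : realType) (K : scalar_kind) :
    {rmorphism scalars R K -> scalars R K} :=
  match K with
  | RealScalars => idfun
  | ComplexScalars => @conjc R
  end.

Definition ofR (R : realType) (K : scalar_kind) :
    {rmorphism R -> scalars R K} :=
  match K with
  | RealScalars => idfun
  | ComplexScalars => real_complex R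
  end.

Definition reF (R : realType) (K : scalar_kind) : scalars R K -> R :=
  match K with
  | RealScalars => fun x => x
  | ComplexScalars => fun x => complex.Re x
  end.

Lemma conjF_ofR (R : realType) (K : scalar_kind) (a : R) :
  conjF R K (ofR R K a) = ofR R K a.
Proof. by case: K => //=; exact: conjc_real. Qed.

Lemma reF_is_zmod_morphism (R : realType) (K : scalar_kind) :
  zmod_morphism (@reF R K).
Proof. by case: K => //= -[a b] [c d]. Qed.

HB.instance Definition _ (R : realType) (K : scalar_kind) :=
  GRing.isZmodMorphism.Build (scalars R K) R (@reF R K)
    (@reF_is_zmod_morphism R K).

Lemma reF_ofRM (R : realType) (K : scalar_kind) (a : R) (x : scalars R K) :
  reF (ofR R K a * x) = a * reF x.
Proof. by case: K x => //= -[b c] /=; rewrite mul0r subr0. Qed.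

Lemma reF_ofR (R : realType) (K : scalar_kind) (a : R) : reF (ofR R K a) = a.
Proof. by case: K. Qed.

Lemma reF_conjM_ge0 (R : realType) (K : scalar_kind) (x : scalars R K) :
  0 <= reF (x * conjF R K x).
Proof.
case: K x => [x|[a b]] /=; first exact: sqr_ge0.
by rewrite mulrN opprK addr_ge0 ?sqr_ge0.
Qed.

Lemma conjF_fixed (R : realType) (K : scalar_kind) (x : scalars R K) :
  conjF R K x = x -> ofR R K (reF x) = x.
Proof.
case: K x => //= -[a b] /= [] /eqP.
by rewrite eq_sym -subr_eq0 opprK -mulr2n mulrn_eq0 /= => /eqP ->.
Qed.

(* Symmetric matrices for real scalars, Hermitian ones for complex scalars;
   the flag [false] selects the sign + in M = +/- (conj M)^T. *)
Definition selfadjmx (R : realType) (K : scalar_kind) (q : nat) :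
    {pred 'M[scalars R K]_q} :=
  fun M => M \is hermitianmx q false (conjF R K).
Arguments selfadjmx : clear implicits.

Record sa (R : realType) (K : scalar_kind) (q : nat) := SA {
  sa_mx :> 'M[scalars R K]_q ;
  sa_mxP : sa_mx \in selfadjmx R K q }.

HB.instance Definition _ (R : realType) (K : scalar_kind) (q : nat) :=
  [isSub for @sa_mx R K q].
HB.instance Definition _ (R : realType) (K : scalar_kind) (q : nat) :=
  [Choice of sa R K q by <:].

Lemma selfadjmxP (R : realType) (K : scalar_kind) (q : nat)
    (M : 'M[scalars R K]_q) :
  reflect (M = map_mx (conjF R K) M^T) (M \in selfadjmx R K q).
Proof.
by apply: (iffP (is_hermitianmxP _ _ _)) => [{1}->|{1}->];
  rewrite expr0 scale1r.
Qed.

Lemma selfadjmx_zmod_closed (R : realType) (K : scalar_kind) (q : nat) :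
  zmod_closed (selfadjmx R K q).
Proof.
split; first by apply/selfadjmxP; rewrite trmx0 map_mx0.
move=> A B /selfadjmxP hA /selfadjmxP hB; apply/selfadjmxP.
by rewrite linearB /= map_mxB -hA -hB.
Qed.

HB.instance Definition _ (R : realType) (K : scalar_kind) (q : nat) :=
  GRing.isZmodClosed.Build 'M[scalars R K]_q (selfadjmx R K q)
    (@selfadjmx_zmod_closed R K q).
HB.instance Definition _ (R : realType) (K : scalar_kind) (q : nat) :=
  [SubChoice_isSubZmodule of sa R K q by <:].

Lemma sa_scale_subproof (R : realType) (K : scalar_kind) (q : nat)
    (a : R) (S : sa R K q) : ofR R K a *: sa_mx S \in selfadjmx R K q.
Proof.
apply/selfadjmxP; rewrite linearZ /= map_mxZ conjF_ofR.
by rewrite -(selfadjmxP _ (sa_mxP S)).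
Qed.

Definition sa_scale (R : realType) (K : scalar_kind) (q : nat)
    (a : R) (S : sa R K q) : sa R K q := SA (sa_scale_subproof a S).

Program Definition sa_lmodMixin (R : realType) (K : scalar_kind) (q : nat) :=
  @GRing.Zmodule_isLmodule.Build R (sa R K q) (@sa_scale R K q) _ _ _ _.
Next Obligation.
by apply: val_inj; rewrite /= scalerA rmorphM.
Qed.
Next Obligation.
by move=> v; apply: val_inj; rewrite /= rmorph1 scale1r.
Qed.
Next Obligation.
by move=> a u v; apply: val_inj; rewrite /= scalerDr.
Qed.
Next Obligation.
by move=> a b; apply: val_inj; rewrite /= rmorphD scalerDl.
Qed.
HB.instance Definition _ (R : realType) (K : scalar_kind) (q : nat) :=
  sa_lmodMixin R K q.

(* Frobenius inner product on self-adjoint matrices. Tr[AB] is already real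
   (see [frob_saE]), so that [reF] only changes its type. *)
Definition frob_sa (R : realType) (K : scalar_kind) (q : nat)
  (A B : sa R K q) : R := reF (\tr (A *m B)).

Lemma frob_saE (R : realType) (K : scalar_kind) (q : nat) (A B : sa R K q) :
  ofR R K (frob_sa A B) = \tr (A *m B).
Proof.
have mapE (S : sa R K q) : map_mx (conjF R K) S = (sa_mx S)^T.
  by rewrite {2}(selfadjmxP _ (sa_mxP S)) map_trmx trmxK.
apply: conjF_fixed.
by rewrite -trace_map_mx map_mxM !mapE -trmx_mul mxtrace_tr mxtrace_mulC.
Qed.

Definition frob_mx (R : realType) (n q : nat) (A B : 'M[R]_(n, q)) : R :=
  \tr (A *m B^T).

Definition is_adjoint (R : realType) (U V : lmodType R)
    (ipU : U -> U -> R) (ipV : V -> V -> R) (f : U -> V) (g : V -> U) :=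
  forall (u : U) (v : V), ipV (f u) v = ipU u (g v).

Definition real_span (R : realType) (V : lmodType R) (X : set V) : set V :=
  [set v | exists (m : nat) (c : 'I_m -> R) (x : 'I_m -> V),
    (forall j, X (x j)) /\ v = \sum_(j < m) c j *: x j].

Record spectral_decomp (R : realType) (K : scalar_kind) (q : nat)
    (O : sa R K q) := SpectralDecomp {
  sd_num : nat ;
  sd_val : 'I_sd_num -> R ;
  sd_proj : 'I_sd_num -> sa R K q ;
  sd_val_inj : injective sd_val ;
  sd_proj_neq0 : forall k, sd_proj k != 0 ;
  sd_projM : forall k k',
    sd_proj k *m sd_proj k' = if k == k' then sa_mx (sd_proj k) else 0 ;
  sd_proj_sum : \sum_k sa_mx (sd_proj k) = 1%:M ;
  sd_sum : O = \sum_k sd_val k *: sd_proj k }.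

Lemma sa_mx_sum (R : realType) (K : scalar_kind) (q : nat) (I : finType)
    (c : I -> R) (x : I -> sa R K q) :
  sa_mx (\sum_i c i *: x i) = \sum_i ofR R K (c i) *: sa_mx (x i).
Proof. exact: (raddf_sum (val : sa R K q -> _)). Qed.

(* The projections are those onto the eigenspaces. *)
Lemma sd_proj_eigenspace (R : realType) (K : scalar_kind) (q : nat)
    (O : sa R K q) (sd : spectral_decomp O) (k : 'I_(sd_num sd)) :
  (sa_mx (sd_proj k) :=: eigenspace (sa_mx O) (ofR R K (sd_val k)))%MS.
Proof.
have OE := congr1 (@sa_mx R K q) (sd_sum sd); rewrite sa_mx_sum in OE.
have OP (l : 'I_(sd_num sd)) : O *m sd_proj l = ofR R K (sd_val l) *: sa_mx (sd_proj l).
  rewrite {1}OE mulmx_suml (bigD1 l) //= big1 ?addr0 => [|j /negPf jl].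
    by rewrite -scalemxAl sd_projM eqxx.
  by rewrite -scalemxAl sd_projM jl scaler0.
have PO (l : 'I_(sd_num sd)) : sd_proj l *m O = ofR R K (sd_val l) *: sa_mx (sd_proj l).
  rewrite {1}OE mulmx_sumr (bigD1 l) //= big1 ?addr0 => [|j].
    by rewrite -scalemxAr sd_projM eqxx.
  by rewrite eq_sym -scalemxAr sd_projM => /negPf ->; rewrite scaler0.
apply/eqmxP/andP; split; first by apply/eigenspaceP.
set E := eigenspace _ _.
have EO : E *m O = ofR R K (sd_val k) *: E by exact/eigenspaceP.
have -> : E = E *m sd_proj k; last exact: submxMl.
rewrite -{1}[E]mulmx1 -(sd_proj_sum sd) mulmx_sumr (bigD1 k) //=.
rewrite big1 ?addr0 // => l lk.
have : (ofR R K (sd_val l) - ofR R K (sd_val k)) *: (E *m sd_proj l) = 0.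
  by rewrite scalerBl scalemxAr -OP mulmxA EO -scalemxAl subrr.
move/eqP; rewrite scaler_eq0 -rmorphB fmorph_eq0 subr_eq0.
by rewrite (inj_eq (@sd_val_inj _ _ _ _ sd)) (negPf lk) => /eqP.
Qed.

Definition mult (R : realType) (K : scalar_kind) (q : nat) (O : sa R K q)
    (sd : spectral_decomp O) (k : 'I_(sd_num sd)) : R :=
  reF (\tr (sd_proj k)).

(* d_k[S] = Tr[S Pi_k] *)
Definition coef (R : realType) (K : scalar_kind) (q : nat) (O : sa R K q)
    (sd : spectral_decomp O) (k : 'I_(sd_num sd)) (S : sa R K q) : R :=
  frob_sa S (sd_proj k).

(* The index l : 'I_q is 0-based, so that l.+1 is the index in {1, ..., q};
   the shift of the index k is immaterial. *)
Definition in_block (R : realType) (K : scalar_kind) (q : nat) (O : sa R K q)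
    (sd : spectral_decomp O) (k : 'I_(sd_num sd)) (l : 'I_q) : bool :=
  \sum_(k' < sd_num sd | (k' < k)%N) mult k' < l.+1%:R
    <= \sum_(k' < sd_num sd | (k' <= k)%N) mult k'.

Lemma mult_ge0 (R : realType) (K : scalar_kind) (q : nat) (O : sa R K q)
    (sd : spectral_decomp O) (k : 'I_(sd_num sd)) : 0 <= mult k.
Proof.
have PE := selfadjmxP _ (sa_mxP (sd_proj k)).
rewrite /mult; have := sd_projM k k; rewrite eqxx => <-.
rewrite {2}PE raddf_sum sumr_ge0 // => i _.
rewrite mxE raddf_sum sumr_ge0 // => j _.
by rewrite !mxE reF_conjM_ge0.
Qed.

Lemma mult_sum (R : realType) (K : scalar_kind) (q : nat) (O : sa R K q)
    (sd : spectral_decomp O) : \sum_k mult (sd := sd) k = q%:R.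
Proof.
transitivity (reF (\tr (\sum_k sa_mx (sd_proj (s := sd) k)))).
  rewrite (raddf_sum (@mxtrace (scalars R K) q)) (raddf_sum (@reF R K)).
  by [].
rewrite sd_proj_sum mxtrace1.
by rewrite -(rmorph_nat (ofR R K)) reF_ofR.
Qed.

Lemma index_map_ex (R : realType) (K : scalar_kind) (q : nat) (O : sa R K q)
    (sd : spectral_decomp O) (l : 'I_q) :
  exists k : 'I_(sd_num sd), in_block k l.
Proof.
have := mult_sum sd; set N := sd_num sd => sumN.
pose P k := (l.+1%:R <= \sum_(k' < N | (k' < k)%N) mult (sd := sd) k').
have exP : exists k, P k.
  exists N; rewrite /P (eq_bigl xpredT) => [|k']; last exact: ltn_ord.
  by rewrite sumN ler_nat.
case: (ex_minnP exP) => -[|k] Pk minP.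
  by move: Pk; rewrite /P big1 ?lern0.
have kN : (k < N)%N.
  rewrite ltnNge; apply/negP => Nk.
  suff : P k by move/minP; rewrite ltnn.
  rewrite /P (eq_bigl xpredT) => [|k']; last exact: leq_trans (ltn_ord _) Nk.
  by rewrite sumN ler_nat.
exists (Ordinal kN); apply/andP; split=> //=.
by rewrite ltNge; apply/negP => /minP; rewrite ltnn.
Qed.

Definition index_map (R : realType) (K : scalar_kind) (q : nat) (O : sa R K q)
    (sd : spectral_decomp O) (l : 'I_q) : 'I_(sd_num sd) :=
  xchoose (index_map_ex sd l).

Lemma index_mapP (R : realType) (K : scalar_kind) (q : nat) (O : sa R K q)
    (sd : spectral_decomp O) (l : 'I_q) (k : 'I_(sd_num sd)) :
  index_map sd l = k <-> in_block k l.
Proof.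
have uniq (k1 k2 : 'I_(sd_num sd)) :
    in_block k1 l -> in_block k2 l -> (k1 <= k2)%N.
  move=> /andP[lt1 _] /andP[_ le2]; rewrite leqNgt; apply/negP => k21.
  have := lt_le_trans lt1 le2; rewrite ltNge => /negP; apply.
  rewrite [leRHS](bigID (fun k' : 'I__ => (k' <= k2)%N)) /=.
  rewrite -[leLHS]addr0 lerD ?sumr_ge0 // => [|k' _]; last exact: mult_ge0.
  rewrite le_eqVlt; apply/orP; left; apply/eqP/eq_bigl => k'.
  by case: (leqP k' k2) => [k'2|]; rewrite ?andbF ?andbT ?(leq_ltn_trans k'2).
have in_im := xchooseP (index_map_ex sd l); split=> [<- //|kl].
by apply/val_inj/anti_leq; rewrite !uniq.
Qed.

Definition design_tensor (R : realType) (K : scalar_kind) (n q : nat)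
    (O : 'I_n -> sa R K q) (sd : forall i, spectral_decomp (O i))
    (S : sa R K q) : 'M[R]_(n, q) :=
  \matrix_(i < n, l < q)
    (coef (index_map (sd i) l) S / mult (index_map (sd i) l)).

Lemma design_tensor_is_linear (R : realType) (K : scalar_kind) (n q : nat)
    (O : 'I_n -> sa R K q) (sd : forall i, spectral_decomp (O i)) :
  linear (design_tensor sd).
Proof.
move=> a S T; apply/matrixP => i l; rewrite !mxE mulrA -mulrDl; congr (_ / _).
rewrite /coef /frob_sa /= mulmxDl -scalemxAl raddfD /= mxtraceZ raddfD /=.
by rewrite reF_ofRM.
Qed.

HB.instance Definition _ (R : realType) (K : scalar_kind) (n q : nat)
    (O : 'I_n -> sa R K q) (sd : forall i, spectral_decomp (O i)) :=
  GRing.isLinear.Build R (sa R K q) 'M[R]_(n, q) *:%R (design_tensor sd)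
    (design_tensor_is_linear sd).

(* The average of the i-th row of A over the block of indices l with
   k_i(l) = k. *)
Definition block_mean (R : realType) (K : scalar_kind) (n q : nat)
    (O : 'I_n -> sa R K q) (sd : forall i, spectral_decomp (O i))
    (A : 'M[R]_(n, q)) (i : 'I_n) (k : 'I_(sd_num (sd i))) : R :=
  (mult k)^-1 * \sum_(l < q | index_map (sd i) l == k) A i l.

Definition design_dual (R : realType) (K : scalar_kind) (n q : nat)
    (O : 'I_n -> sa R K q) (sd : forall i, spectral_decomp (O i))
    (A : 'M[R]_(n, q)) : sa R K q :=
  \sum_(i < n) \sum_(k < sd_num (sd i)) block_mean A k *: sd_proj k.

Definition complete_design (R : realType) (K : scalar_kind) (n q : nat)
    (O : 'I_n -> sa R K q) (sd : forall i, spectral_decomp (O i)) :=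
  forall D : sa R K q, \tr (sa_mx D) = 0 ->
    (forall (i : 'I_n) (k : 'I_(sd_num (sd i))), coef k D = 0) <-> D = 0.

Definition eigenprojections (R : realType) (K : scalar_kind) (n q : nat)
    (O : 'I_n -> sa R K q) (sd : forall i, spectral_decomp (O i)) :
    set (sa R K q) :=
  [set P | exists (i : 'I_n) (k : 'I_(sd_num (sd i))), P = sd_proj k].

(* Main.v *)
(* The entries of D[S] are inner products <S, Pi_ik> / m_ik and each block of
   indices l is nonempty (m_ik is the rank of Pi_ik), so ker D is the orthogonal
   complement of the span of the Pi_ik, and D is injective iff they span. For
   n > 0 this complement consists of traceless matrices, because the Pi_ik sum
   to 1 over k. *)

Require Import Defs.
From HB Require Import structures.
From mathcomp Require Import all_boot all_order all_algebra.
From mathcomp Require Import boolp classical_sets reals.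

Set Implicit Arguments.
Unset Strict Implicit.
Unset Printing Implicit Defensive.

Import Order.TTheory GRing.Theory Num.Theory.
Local Open Scope ring_scope.

(** Factor P = C R through [col_base] and [row_base]: P P = P cancels to R C = 1, whose trace is the
    rank. *)
Lemma mxtrace_idempotent (F : fieldType) (q : nat) (P : 'M[F]_q) :
  P *m P = P -> \tr P = (\rank P)%:R.
Proof.
move=> PP; rewrite -{1}(mulmx_base P) mxtrace_mulC.
suff -> : row_base P *m col_base P = 1%:M by rewrite mxtrace1.
apply: (row_full_inj (col_base_full P)); rewrite mulmxA mulmx1.
apply: (row_free_inj (row_base_free P)).
by rewrite /= mulmx_base -mulmxA mulmx_base.
Qed.

(* The normal equations c G = b for the Gram matrix G of the X_j are solvable,
   even when the X_j are dependent: if G u = 0 then the combination of the X_j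
   with coefficients u is orthogonal to itself, hence zero, so that b u = 0. *)
Lemma orthogonal_remainder (F : fieldType) (V : lmodType F)
    (ip : V -> {scalar V}) (m : nat) (X : 'I_m -> V) (v : V) :
  (forall u w, ip u w = ip w u) -> (forall u, ip u u = 0 -> u = 0) ->
  exists c : 'I_m -> F, forall j, ip (v - \sum_k c k *: X k) (X j) = 0.
Proof.
move=> ipC ip_def.
pose G : 'M[F]_m := \matrix_(i, j) ip (X i) (X j).
pose b : 'rV[F]_m := \row_j ip v (X j).
have ip_sumr u (c : 'I_m -> F) :
    ip u (\sum_k c k *: X k) = \sum_k c k * ip u (X k).
  by rewrite linear_sum; apply: eq_bigr => k _; rewrite linearZ.
have : (b <= G)%MS.
  rewrite submxE; apply/eqP/rowP => j.
  move: (cokermx G) (mulmx_coker G) => C GC.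
  (* Column j of [C] is a vector u with G u = 0, and [y] is the combination of the X_k with
     coefficients u. *)
  rewrite !mxE; pose y := \sum_k C k j *: X k.
  have y0 : y = 0.
    apply: ip_def; rewrite {2}/y ip_sumr big1 // => i _.
    have := congr1 (fun M : 'M_m => M i j) GC; rewrite !mxE => GCij.
    rewrite ipC ip_sumr; apply/eqP; rewrite mulf_eq0 -[X in _ || (_ == X)]GCij.
    by apply/orP; right; apply/eqP/eq_bigr => k _; rewrite mxE mulrC.
  transitivity (ip v y); last by rewrite y0 linear0.
  by rewrite ip_sumr; apply: eq_bigr => k _; rewrite mxE mulrC.
case/submxP => c bE; exists (fun k => c 0 k) => j.
rewrite ipC linearB ip_sumr ipC.
have := congr1 (fun M : 'rV_m => M 0 j) bE; rewrite !mxE => ->.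
apply/eqP; rewrite subr_eq0; apply/eqP/eq_bigr => k _.
by rewrite mxE ipC.
Qed.

Section FrobeniusProduct.
Variables (R : realType) (K : scalar_kind) (q : nat).
Implicit Types A B : sa R K q.

Lemma frob_saC A B : frob_sa A B = frob_sa B A.
Proof. by rewrite /frob_sa mxtrace_mulC. Qed.

Lemma frob_sa_is_scalar A : scalar (frob_sa A).
Proof.
move=> a B C; rewrite /frob_sa /= mulmxDr -scalemxAr raddfD /= mxtraceZ.
by rewrite raddfD /= reF_ofRM.
Qed.

HB.instance Definition _ A :=
  GRing.isLinear.Build R (sa R K q) R *%R (frob_sa A) (frob_sa_is_scalar A).

Lemma reF_conjM_eq0 (x : scalars R K) : reF (x * conjF R K x) = 0 -> x = 0.
Proof.
case: K x => [x|[a b]] /=; first by move/eqP; rewrite mulf_eq0 orbb => /eqP.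
rewrite mulrN opprK => /eqP.
by rewrite paddr_eq0 ?sqr_ge0 // !mulf_eq0 !orbb => /andP[/eqP-> /eqP->].
Qed.

(** Since A equals its conjugate transpose, Tr[AA] is the sum of all |a_ij|^2. *)
Lemma frob_sa_definite A : frob_sa A A = 0 -> A = 0.
Proof.
move=> A0; apply/val_inj/matrixP => i j; rewrite [RHS]mxE.
apply: reF_conjM_eq0.
have AE := selfadjmxP _ (sa_mxP A).
move: A0; rewrite /frob_sa {2}AE raddf_sum => /eqP.
have ge0 k l : 0 <= reF (sa_mx A k l * (map_mx (conjF R K) A^T) l k).
  by rewrite !mxE reF_conjM_ge0.
rewrite psumr_eq0 => [/allP/(_ i (mem_index_enum _)) /=|k _].
  rewrite mxE raddf_sum psumr_eq0 => [|l _]; last exact: ge0.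
  by move=> /allP/(_ j (mem_index_enum _)) /=; rewrite !mxE => /eqP.
by rewrite mxE raddf_sum; apply: sumr_ge0 => l _; exact: ge0.
Qed.

(** Nondegeneracy, by testing on S = A - B; it yields uniqueness of the adjoint. *)
Lemma frob_sa_inj A B : (forall S, frob_sa S A = frob_sa S B) -> A = B.
Proof.
move=> AB; apply/eqP; rewrite -subr_eq0; apply/eqP/frob_sa_definite.
by rewrite linearB /= AB subrr.
Qed.

End FrobeniusProduct.

Section Multiplicities.
Variables (R : realType) (K : scalar_kind) (q : nat) (O : sa R K q).
Variable sd : spectral_decomp O.
Implicit Type k : 'I_(sd_num sd).

Lemma mult_rank k : mult k = (\rank (sa_mx (sd_proj k)))%:R.
Proof.
rewrite /mult mxtrace_idempotent; last by rewrite sd_projM eqxx.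
by rewrite -(rmorph_nat (ofR R K)) reF_ofR.
Qed.

Lemma sd_proj_rank_gt0 k : (0 < \rank (sa_mx (sd_proj k)))%N.
Proof.
rewrite lt0n mxrank_eq0; apply/eqP => P0.
by have /eqP[] := sd_proj_neq0 k; apply: val_inj.
Qed.

Lemma mult_neq0 k : mult k != 0.
Proof. by rewrite mult_rank pnatr_eq0 -lt0n sd_proj_rank_gt0. Qed.

(** Since Pi_k is nonzero, its multiplicity is a positive integer, so block k has a first index. *)
Lemma index_map_surj k : exists l : 'I_q, Defs.index_map sd l = k.
Proof.
(* The blocks before k fill the 0-based indices below [s], so [s] itself is the first index of block
   k. *)
pose s := (\sum_(k' < sd_num sd | (k' < k)%N) \rank (sa_mx (sd_proj k')))%N.
have sE : \sum_(k' < sd_num sd | (k' < k)%N) mult k' = s%:R.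
  by rewrite natr_sum; apply: eq_bigr => k' _; rewrite mult_rank.
have sumE : \sum_(k' < sd_num sd | (k' <= k)%N) mult k' = s%:R + mult k.
  rewrite (bigD1 k) //= addrC -sE; congr (_ + _).
  by apply: eq_bigl => k'; rewrite ltn_neqAle andbC.
have sS : s.+1%:R <= s%:R + mult k :> R.
  by rewrite mult_rank -natrD ler_nat -addn1 leq_add2l sd_proj_rank_gt0.
have sq : (s < q)%N.
  rewrite -(ler_nat R) (le_trans sS) // -(mult_sum sd) -sumE.
  rewrite [leRHS](bigID (fun k' : 'I__ => (k' <= k)%N)) /=.
  by rewrite lerDl sumr_ge0 // => k' _; exact: mult_ge0.
exists (Ordinal sq); apply/index_mapP.
by rewrite /in_block sE sumE /= ltr_nat ltnSn.
Qed.

(** The Pi_k sum to 1, so Tr[S] is the sum of the d_k[S]. *)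
Lemma mxtrace_coef (S : sa R K q) :
  (forall k, coef k S = 0) -> \tr (sa_mx S) = 0.
Proof.
move=> S0; rewrite -[sa_mx S]mulmx1 -(sd_proj_sum sd) mulmx_sumr raddf_sum.
apply: big1 => k _; apply/esym; have := frob_saE S (sd_proj k).
by rewrite [frob_sa _ _]S0 rmorph0.
Qed.

End Multiplicities.

Section Design.
Variables (R : realType) (K : scalar_kind) (n q : nat) (O : 'I_n -> sa R K q).
Variable sd : forall i : 'I_n, spectral_decomp (O i).

(** Each row of D[S] is constant on blocks, so pairing it with A sums A over each block; the factor
    1/m_ik of D[S] turns these sums into means. *)
Lemma design_dual_adjoint :
  is_adjoint (@frob_sa R K q) (@frob_mx R n q) (design_tensor sd)
    (design_dual sd).
Proof.
move=> S A; rewrite /frob_mx /mxtrace /design_dual linear_sum.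
apply: eq_bigr => i _; rewrite mxE linear_sum.
rewrite (partition_big (Defs.index_map (sd i)) xpredT) //=.
apply: eq_bigr => k _; rewrite linearZ /= /block_mean -mulrA mulrCA.
rewrite mulr_suml; apply: eq_bigr => l /eqP lk.
by rewrite !mxE lk mulrC [_ / _]mulrC.
Qed.

(** No block is empty, so every d_ik[S] appears in some entry, divided by m_ik != 0. *)
Lemma design_tensor_eq0 (S : sa R K q) :
  design_tensor sd S = 0 <->
  forall (i : 'I_n) (k : 'I_(sd_num (sd i))), coef k S = 0.
Proof.
split=> [S0 i k|S0]; last by apply/matrixP => i l; rewrite !mxE S0 mul0r.
have [l <-] := index_map_surj k.
have /eqP := congr1 (fun M : 'M_(n, q) => M i l) S0.
by rewrite !mxE mulf_eq0 invr_eq0 (negPf (mult_neq0 _)) orbF => /eqP.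
Qed.

Lemma real_span_eigenprojections :
  (forall S : sa R K q,
    (forall (i : 'I_n) (k : 'I_(sd_num (sd i))), coef k S = 0) -> S = 0) ->
  real_span (eigenprojections sd) = [set: sa R K q]%classic.
Proof.
move=> S0; apply/seteqP; split=> // S _.
(* The pairs (i, k) form one finite type, whose enumeration makes the projections a single family
   indexed by ordinals. *)
pose T := {i : 'I_n & 'I_(sd_num (sd i))}.
pose X (j : 'I_#|{: T}|) := sd_proj (tagged (enum_val j)).
have [c cP] := orthogonal_remainder
  (ip := fun A => frob_sa A : {scalar sa R K q}) X S
  (@frob_saC R K q) (@frob_sa_definite R K q).
exists _, c, X; split=> [j|].
  by exists (tag (enum_val j)), (tagged (enum_val j)).
(* The remainder of S is orthogonal to every Pi_ik, hence zero by hypothesis. *)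
apply/eqP; rewrite -subr_eq0; apply/eqP/S0 => i k.
have := cP (enum_rank (Tagged (fun i => 'I_(sd_num (sd i))) k)).
by rewrite /X enum_rankK.
Qed.

Lemma orthogonal_real_span (X : set (sa R K q)) (S T : sa R K q) :
  (forall P, X P -> frob_sa S P = 0) -> real_span X T -> frob_sa S T = 0.
Proof.
move=> SX [m [c [x [xX ->]]]]; rewrite linear_sum big1 // => j _.
by rewrite linearZ /= SX ?mulr0.
Qed.

End Design.

(** Serves to refute completeness of the empty design, n = 0. *)
Lemma traceless_sa_neq0 (R : realType) (K : scalar_kind) (q : nat) :
  (2 <= q)%N -> exists2 D : sa R K q, \tr (sa_mx D) = 0 & D <> 0.
Proof.
case: q => [|[|q]] // _.
(* The matrix is diag(1, 0, ..., 0, -1). *)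
pose d : 'rV[scalars R K]_q.+2 := delta_mx 0 ord0 - delta_mx 0 ord_max.
have saD : diag_mx d \in selfadjmx R K q.+2.
  apply/selfadjmxP; rewrite tr_diag_mx map_diag_mx; congr diag_mx.
  by rewrite map_mxB !map_delta_mx.
exists (SA saD) => /=.
  rewrite mxtrace_diag /d.
  under eq_bigr do rewrite !mxE.
  rewrite sumrB /= (bigD1 ord0) //= big1 => [|i /negPf->//].
  rewrite (bigD1 ord_max) //= big1 => [|i /negPf->//].
  by rewrite eqxx !addr0 subrr.
move/(congr1 (fun D : sa R K q.+2 => sa_mx D ord0 ord0))/eqP.
by rewrite !mxE /= subr0 oner_eq0.
Qed.

Theorem proposition4p3 (R : realType) (K : scalar_kind) (n q : nat)
    (hq : (2 <= q)%N) (O : 'I_n -> sa R K q)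
    (sd : forall i : 'I_n, spectral_decomp (O i))
    (hqi : forall i : 'I_n, (2 <= sd_num (sd i))%N) :
  (forall g : 'M[R]_(n, q) -> sa R K q,
     is_adjoint (@frob_sa R K q) (@frob_mx R n q) (design_tensor sd) g
     <-> (forall A : 'M[R]_(n, q), g A = design_dual sd A))
  /\ [<-> complete_design sd;
          real_span (eigenprojections sd) = [set: sa R K q]%classic;
          injective (design_tensor sd)].
Proof.
split=> [g|].
  split=> [gP A|gE S A]; last by rewrite gE design_dual_adjoint.
  by apply: frob_sa_inj => S; rewrite -gP design_dual_adjoint.
tfae=> [complete|spanT|D_inj].
- apply: real_span_eigenprojections => S S0.
  apply/complete => //.
  (* Without observables no trace condition follows from the coefficients, but
     then completeness fails since q >= 2. *)
  case: n O sd hqi complete S0 => [|n] O sd hqi complete S0.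
    have [D trD []] := traceless_sa_neq0 R K hq.
    by apply/complete => // -[].
  exact: (mxtrace_coef (S0 ord0)).
(* A kernel element S is orthogonal to the span, which is everything, hence to itself. *)
- apply: raddf_inj => S /design_tensor_eq0 S0; apply: frob_sa_definite.
  apply: (@orthogonal_real_span _ _ _ (eigenprojections sd)); last by rewrite spanT.
  by move=> _ [i [k ->]]; exact: S0.
- move=> D trD; rewrite -design_tensor_eq0; split=> [D0|->]; last exact: linear0.
  by apply: D_inj; rewrite D0 linear0.
Qed.
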